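(* Let $s\ge 1$ and $t\ge 0$ be integers and let $G$ be a group (not necessarily finite) such that the index $|\gamma_{s}(G):\gamma_{s}(G)\cap Z_t(G)|$ is finite. Then the index $|\gamma_{s+j}(G):\gamma_{s+j}(G)\cap Z_{t-j}(G)|$ is finite for every integer $j$ such that $0\le j\le t$. In particular, $\gamma_{s+t}(G)$ is finite.
   Context: For a group $G$, $\gamma_k(G)$ denotes the $k$-th term of the lower central series: $\gamma_1(G)=G$ and $\gamma_{k+1}(G)=[\gamma_k(G),G]$ for $k\ge 1$. $Z_k(G)$ denotes the $k$-th term of the upper central series: $Z_0(G)=1$ and $Z_{k+1}(G)/Z_k(G)=Z(G/Z_k(G))$ for $k\ge 0$; in particular $Z_1(G)=Z(G)$ is the center. *)

(* Defs.v *)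
(* [groupType] is MathComp's type of arbitrary, possibly
   infinite, groups; subsets of a group are [set G] from [classical_sets]. *)
From mathcomp Require Export ssreflect ssrfun ssrbool eqtype ssrnat choice monoid.
From mathcomp Require Export boolp classical_sets functions cardinality.

Set Implicit Arguments.
Unset Strict Implicit.
Unset Printing Implicit Defensive.

Local Open Scope group_scope.
Local Open Scope classical_set_scope.

Definition subgroup (G : groupType) (H : set G) : Prop := group_closed (mem H).

Definition generated (G : groupType) (A : set G) : set G :=
  smallest (@subgroup G) A.

Definition commutator (G : groupType) (A B : set G) : set G :=
  generated [set [~ a, b] | a in A & b in B].

Definition lcoset (G : groupType) (K : set G) (x : G) : set G :=
  [set x * k | k in K].

(* The set of left cosets [x K] with [x] in [H]; it is [H / K] when [K] is a
   subgroup of [H]. *)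
Definition lcosets (G : groupType) (H K : set G) : set (set G) :=
  [set lcoset K x | x in H].

Definition finite_index (G : groupType) (H K : set G) : Prop :=
  finite_set (lcosets H K).

Definition setmul (G : groupType) (A B : set G) : set G :=
  [set a * b | a in A & b in B].

(* Z(G / N), as a set of cosets.  For a normal subgroup [N] the product of two
   cosets in G / N is their elementwise product. *)
Definition center_quotient (G : groupType) (N : set G) : set (set G) :=
  [set C | lcosets [set: G] N C /\
     forall D, lcosets [set: G] N D -> setmul C D = setmul D C].

(* Numbered from 1 as in gamma_1(G) = G; the value at 0 is also G, the same
   convention as for ['L_n(G)] in MathComp's [nilpotent]. *)
Definition lower_central (G : groupType) (k : nat) : set G :=
  iter k.-1 (fun H => commutator H [set: G]) [set: G].

(* Z_(k+1)(G) is the preimage of Z(G / Z_k(G)) under G -> G / Z_k(G). *)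
Definition upper_central (G : groupType) (k : nat) : set G :=
  iter k (fun Z : set G => [set x | center_quotient Z (lcoset Z x)]) [set 1].

Arguments lower_central G k : clear implicits.
Arguments upper_central G k : clear implicits.

(* Main.v *)
(* It suffices to pass from (s, t + 1) to (s + 1, t); dividing by Z_t(G) this
   becomes: if gamma_s(G) is covered by finitely many cosets of the center,
   then gamma_(s+1)(G) is finite.

   First, every a in gamma_i has finitely many conjugates under
   gamma_(s+1-i), for 1 <= i <= s, by induction on i.  If a = [b, x] with b in
   gamma_i and w is in gamma_(s-i), then a^w = [b^w, x^w], where
   b^w = b [b, w] and [b, w] is in gamma_s, hence equal to some u from a fixed
   finite set up to a central factor, and x^w = x v with v in gamma_(s-i+1).
   So a^w = [bu, xv] is determined by u and by the conjugate of (bu)^x under v,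
   and the induction hypothesis applies to (bu)^x.

   For i = s this shows that the set X of the commutators x = [a, g] with a in
   gamma_s is finite.  Some power x^(m+1) is central, and then x^(m+2) is a
   product of m + 1 elements of X, so that, as in Dietzmann's lemma, every
   product of elements of X equals one of bounded length. *)
From HB Require Import structures.
From mathcomp Require Import seq bigop generic_quotient.
Require Import Defs.

Set Implicit Arguments.
Unset Strict Implicit.
Unset Printing Implicit Defensive.

Local Open Scope quotient_scope.
Local Open Scope group_scope.
Local Open Scope classical_set_scope.

(** Expands conjugates and commutators into products and cancels; [rewrite !gsimp] serves to settle
    identities valid in all groups. *)
Definition gsimp (G : groupType) :=
  (@conjgE G, @commgEl G, @invgM G, @invgK G, @mulgA G, @mulgK G, @mulgVK G,
   @mulVg G, @mulgV G, @mul1g G, @mulg1 G, @invg1 G).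

(** * Subgroups, normal subgroups and cosets *)

Section Subgroups.
Variable G : groupType.
Implicit Types (A H K N S : set G) (x y z g : G).

Lemma subgroupP H :
  subgroup H <-> H 1 /\ forall x y, H x -> H y -> H (x / y).
Proof.
split=> [[H1 HF]|[H1 HF]]; split.
- by move: H1; rewrite !inE.
- by move=> x y Hx Hy; have := HF x y; rewrite !inE; apply.
- by rewrite !inE.
- by move=> x y; rewrite !inE; apply: HF.
Qed.

Section Closure.
Variables (H : set G) (sH : subgroup H).

Lemma subgroup1 : H 1. Proof. by case/subgroupP: sH. Qed.

Lemma subgroupF x y : H x -> H y -> H (x / y).
Proof. by case/subgroupP: sH => _; apply. Qed.

Lemma subgroupV x : H x -> H x^-1.
Proof.
by move=> Hx; rewrite -div1g; apply: subgroupF => //; exact: subgroup1.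
Qed.

Lemma subgroupM x y : H x -> H y -> H (x * y).
Proof. by move=> Hx /subgroupV Hy; rewrite -[y]invgK; exact: subgroupF. Qed.

End Closure.

Lemma subgroup_generated A : subgroup (generated A).
Proof.
apply/subgroupP; split=> [B [sB _]|x y Ax Ay B sAB]; first exact: subgroup1.
by apply: (subgroupF sAB.1); [apply: Ax|apply: Ay].
Qed.

Lemma mem_generated A x : A x -> generated A x.
Proof. by move=> Ax B [_]; apply. Qed.

Lemma generated_sub A H : subgroup H -> A `<=` H -> generated A `<=` H.
Proof. by move=> sH sAH x; apply. Qed.

Definition normal N := subgroup N /\ forall x g, N x -> N (x ^ g).

Lemma normal_subgroup N : normal N -> subgroup N. Proof. by case. Qed.

Lemma normal_generated A :
  (forall x g, A x -> A (x ^ g)) -> normal (generated A).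
Proof.
move=> nA; split=> [|x g]; first exact: subgroup_generated.
move: x; apply: (@generated_sub A [set x | generated A (x ^ g)]); last first.
  by move=> x Ax; apply: mem_generated; apply: nA.
apply/subgroupP; split=> [|x y Ax Ay] /=.
  by rewrite conj1g; apply: subgroup1; apply: subgroup_generated.
by rewrite conjMg conjVg; apply: (subgroupF (subgroup_generated _)).
Qed.

Definition eq_coset N x y := `[< N (x^-1 * y) >].

Lemma lcosetE N : subgroup N -> forall x y, lcoset N x y <-> N (x^-1 * y).
Proof.
move=> sN x y; split=> [[k Nk <-]|Nxy]; first by rewrite mulKg.
by exists (x^-1 * y) => //; rewrite mulVKg.
Qed.

Lemma lcoset_eq N : subgroup N ->
  forall x y, lcoset N x = lcoset N y <-> N (x^-1 * y).
Proof.
move=> sN x y; split=> [e|Nxy].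
  by apply/(lcosetE sN); rewrite e; apply/(lcosetE sN);
    rewrite mulVg; exact: subgroup1.
apply/seteqP; split=> z /(lcosetE sN) h; apply/(lcosetE sN).
  rewrite (_ : _ * _ = (x^-1 * y)^-1 * (x^-1 * z)); last by rewrite !gsimp.
  by apply: subgroupM => //; apply: subgroupV.
rewrite (_ : _ * _ = (x^-1 * y) * (y^-1 * z)); last by rewrite !gsimp.
exact: subgroupM.
Qed.

Lemma setmul_lcoset N : normal N ->
  forall x y, setmul (lcoset N x) (lcoset N y) = lcoset N (x * y).
Proof.
move=> [sN nN] x y; apply/seteqP; split=> z.
  case=> _ [k Nk <-] [_ [l Nl <-] <-]; apply/(lcosetE sN).
  rewrite (_ : _ * _ = k ^ y * l); last by rewrite !gsimp.
  by apply: subgroupM => //; apply: nN.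
case=> k Nk <-; exists x.
  by exists 1; rewrite ?mulg1 //; exact: subgroup1.
by exists (y * k); [exists k|rewrite mulgA].
Qed.

End Subgroups.

(** * The quotient by a normal subgroup, as a group *)

Section Quotient.
Variables (G : groupType) (N : set G) (nN : normal N).

Let sN := normal_subgroup nN.

Lemma eq_coset_refl : reflexive (eq_coset N).
Proof. by move=> x; apply/asboolP; rewrite mulVg; exact: subgroup1. Qed.

Lemma eq_coset_sym : symmetric (eq_coset N).
Proof.
by move=> x y; apply: asbool_equiv_eq; split=> /(subgroupV sN); rewrite !gsimp.
Qed.

Lemma eq_coset_trans : transitive (eq_coset N).
Proof.
move=> y x z /asboolP Nxy /asboolP Nyz; apply/asboolP.
by have := subgroupM sN Nxy Nyz; rewrite !gsimp.
Qed.

Definition coset_equiv :=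
  EquivRel (eq_coset N) eq_coset_refl eq_coset_sym eq_coset_trans.

(** The cosets are packed as a type that can carry a [groupType] structure, so that results about
    all groups apply to G / N. *)
Definition quotient : Type := {eq_quot coset_equiv}%qT.
HB.instance Definition _ := Choice.on quotient.
HB.instance Definition _ := Quotient.on quotient.

Definition proj (x : G) : quotient := \pi_quotient x.

Lemma projP x y : proj x = proj y <-> N (x^-1 * y).
Proof.
by split=> [/eqmodP/asboolP //|h]; apply/eqmodP/asboolP.
Qed.

Lemma proj_repr (u : quotient) : proj (repr u) = u.
Proof. exact: reprK. Qed.

Definition quotient_mul (u v : quotient) := proj (repr u * repr v).
Definition quotient_inv (u : quotient) := proj (repr u)^-1.

Lemma quotient_mul_proj x y : quotient_mul (proj x) (proj y) = proj (x * y).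
Proof.
apply/projP; have /projP Nx := proj_repr (proj x).
have /projP Ny := proj_repr (proj y).
(* Normality makes the product independent of the representatives. *)
rewrite (_ : _ * _ = ((repr (proj x))^-1 * x) ^ repr (proj y) *
  ((repr (proj y))^-1 * y)).
  by apply: subgroupM => //; apply: nN.2.
by rewrite !gsimp.
Qed.

Lemma quotient_inv_proj x : quotient_inv (proj x) = proj x^-1.
Proof.
apply/projP; have /projP/(subgroupV sN) Nx := proj_repr (proj x).
rewrite (_ : _ * _ = ((repr (proj x))^-1 * x)^-1 ^ x^-1); first exact: nN.2.
by rewrite !gsimp.
Qed.

Fact quotient_mulA : associative quotient_mul.
Proof.
move=> u v w; rewrite -[u]proj_repr -[v]proj_repr -[w]proj_repr.
by rewrite !quotient_mul_proj mulgA.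
Qed.

Fact quotient_mul1 : left_id (proj 1) quotient_mul.
Proof. by move=> u; rewrite -[u]proj_repr quotient_mul_proj mul1g. Qed.

Fact quotient_mulg1 : right_id (proj 1) quotient_mul.
Proof. by move=> u; rewrite -[u]proj_repr quotient_mul_proj mulg1. Qed.

Fact quotient_mulV : left_inverse (proj 1) quotient_inv quotient_mul.
Proof.
by move=> u; rewrite -[u]proj_repr quotient_inv_proj quotient_mul_proj mulVg.
Qed.

Fact quotient_mulgV : right_inverse (proj 1) quotient_inv quotient_mul.
Proof.
by move=> u; rewrite -[u]proj_repr quotient_inv_proj quotient_mul_proj mulgV.
Qed.

HB.instance Definition _ := isGroup.Build quotient
  quotient_mulA quotient_mul1 quotient_mulg1 quotient_mulV quotient_mulgV.

Fact proj_is_morphism : {morph proj : x y / x / y}.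
Proof.
by move=> x y; rewrite -quotient_mul_proj -quotient_inv_proj.
Qed.

HB.instance Definition _ := 
  isGroupMorphism.Build G quotient proj proj_is_morphism.

End Quotient.

(** * Central series, and finite index through representatives *)

Section CentralSeries.
Variable G : groupType.
Implicit Types (H N : set G) (a b u v w x y z g : G) (i j k n : nat).

(** For fixed w and a normal subgroup L, this shows that the a with [a, w] in L are closed under
    division. *)
Lemma commgFl a b w : [~ a / b, w] = ([~ a, w] / [~ b, w]) ^ b^-1.
Proof. by rewrite !gsimp. Qed.

Lemma normal_lower_central n : normal (lower_central G n).
Proof.
have nT : normal [set: G] by split=> //; apply/subgroupP.
rewrite /lower_central; elim: n.-1 => //= m [_ nH].
apply: normal_generated => _ g [a Ha [b _ <-]].
by exists (a ^ g); [exact: nH|exists (b ^ g); rewrite ?conjRg].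
Qed.

Lemma subgroup_lower_central n : subgroup (lower_central G n).
Proof. exact: normal_subgroup (normal_lower_central n). Qed.

Lemma commg_lower_central n x g :
  lower_central G n.+1 x -> lower_central G n.+2 [~ x, g].
Proof. by move=> Hx; apply: mem_generated; exists x => //; exists g. Qed.

(** Induction on generators. The indices start at n.+1 because gamma_(k+1) = [gamma_k, G] fails in
    general for the conventional value at k = 0. *)
Lemma lower_centralS_sub n H : subgroup H ->
  (forall b x, lower_central G n.+1 b -> H [~ b, x]) ->
  lower_central G n.+2 `<=` H.
Proof.
by move=> sH h; apply: generated_sub => // _ [b Hb [x _ <-]]; apply: h.
Qed.

Lemma lower_central_sub m n : m <= n ->
  lower_central G n `<=` lower_central G m.
Proof.
move=> /subnKC <-; elim: (n - m) => [|k IH]; first by rewrite addn0.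
apply: subset_trans IH; rewrite addnS; case: (m + k) => [//|l].
apply: lower_centralS_sub; first exact: subgroup_lower_central.
move=> b x Hb; rewrite commgEl.
have [sL nL] := normal_lower_central l.+1.
by apply: subgroupM => //; [apply: subgroupV|apply: nL].
Qed.

(** Induction on i with j free. Let a = [b, x] with b in gamma_(i+1). The hypothesis at j + 1
    applies to [x, w], which is one term deeper than w; the hypothesis at j puts [b, w] in
    gamma_(i+j+2), so its commutators are one term deeper still. *)
Lemma commg_lower_central2 i j a w : lower_central G i.+1 a ->
  lower_central G j.+1 w -> lower_central G (i + j).+2 [~ a, w].
Proof.
elim: i j a w => [|i IH] j a w.
  move=> _ Hw; rewrite -invgR; apply: (subgroupV (subgroup_lower_central _)).
  exact: commg_lower_central.
rewrite addSn; set L := lower_central G (i + j).+3.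
have [sL nL] : normal L := normal_lower_central _.
move=> Ha Hw; suff: lower_central G i.+2 `<=` [set a | L [~ a, w]].
  by move/(_ _ Ha).
apply: lower_centralS_sub => [|b x Hb] /=.
  apply/subgroupP; split=> [|y z Ly Lz] /=.
    by rewrite comm1g; apply: (subgroup1 sL).
  by rewrite commgFl; apply: nL; apply: (subgroupF sL).
set c := [~ b, x]; set u := [~ b, w]; set v := [~ x, w].
have Lu z : L [~ u, z] by apply: commg_lower_central; apply: IH.
have Hv : lower_central G j.+2 v.
  rewrite /v -invgR; apply: (subgroupV (subgroup_lower_central _)).
  exact: commg_lower_central.
have Lv d : lower_central G i.+1 d -> L [~ d, v].
  by move=> Hd; have := IH j.+1 d v Hd Hv; rewrite addnS.
(* Expand [c, w] = c^-1 * [b * u, x * v], using b ^ w = b * u and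
   x ^ w = x * v. *)
have -> : [~ c, w] =
    [~ b, v] ^ c * [~ c, v] * [~ u, [~ b, x * v]]^-1 * [~ u, x * v].
  by rewrite /c /u /v !gsimp.
have Hc : lower_central G i.+1 c.
  by apply: lower_central_sub (leqnSn _) _ _; apply: commg_lower_central.
apply: (subgroupM sL) => //; apply: (subgroupM sL) => //;
  last exact: (subgroupV sL).
by apply: (subgroupM sL) => //; [apply: nL|]; apply: Lv.
Qed.

(** The cosets x N and g N commute exactly when (g x)^-1 (x g) = [x, g] lies in N. *)
Lemma center_quotientP N : normal N ->
  forall x, center_quotient N (lcoset N x) <-> forall g, N [~ x, g].
Proof.
move=> nN x; have sN := normal_subgroup nN.
have E g : setmul (lcoset N x) (lcoset N g) = setmul (lcoset N g) (lcoset N x)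
    <-> N [~ x, g].
  rewrite !setmul_lcoset //; split=> [/esym|Nc]; last apply/esym;
  by [move/(lcoset_eq sN); rewrite !gsimp
     |apply/(lcoset_eq sN); move: Nc; rewrite !gsimp].
split=> [[_ h] g|h]; first by apply/E/h; exists g.
by split=> [|_ [g _ <-]]; [exists x|apply/E].
Qed.

Lemma normal_upper_central k : normal (upper_central G k).
Proof.
elim: k => [|k nZ].
  split=> [|x g /= ->]; last by rewrite conj1g.
  by apply/subgroupP; split=> // x y -> ->; rewrite /= mulgV.
have [sZ cZ] := nZ.
split=> [|x g /(center_quotientP nZ) Zx].
  apply/subgroupP; split=>
    [|x y /(center_quotientP nZ) Zx /(center_quotientP nZ) Zy];
    apply/(center_quotientP nZ) => g.
  - by rewrite comm1g; apply: (subgroup1 sZ).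
  - by rewrite commgFl; apply: cZ; apply: (subgroupF sZ).
apply/(center_quotientP nZ) => h.
by rewrite -[h](conjgKV g) -conjRg; apply: cZ.
Qed.

Lemma upper_centralSP k x :
  upper_central G k.+1 x <-> forall g, upper_central G k [~ x, g].
Proof. exact: center_quotientP (normal_upper_central k) x. Qed.

(** Elements, unlike cosets, are easily mapped to a quotient and lifted back. As the representatives
    lie in H, comparing modulo N is enough. *)
Lemma finite_indexP H N : subgroup H -> subgroup N ->
  finite_index H (H `&` N) <->
  exists S, [/\ finite_set S, S `<=` H &
                forall x, H x -> exists2 u, S u & N (u^-1 * x)].
Proof.
move=> sH sN; have sHN : subgroup (H `&` N).
  apply/subgroupP; split=> [|x y [Hx Nx] [Hy Ny]]; split;
  by [exact: subgroup1|exact: subgroupF].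
split=> [fHN|[S [fS SH cS]]]; last first.
  apply: sub_finite_set (finite_image (lcoset (H `&` N)) fS) => _ [x Hx <-].
  have [u Su Nux] := cS x Hx; exists u => //; apply/(lcoset_eq sHN); split=> //.
  by apply: subgroupM => //; apply: subgroupV => //; apply: SH.
pose rep C := xget 1 [set x | H x /\ lcoset (H `&` N) x = C].
have repP x : H x -> H (rep (lcoset (H `&` N) x)) /\
    lcoset (H `&` N) (rep (lcoset (H `&` N) x)) = lcoset (H `&` N) x.
  by move=> Hx; rewrite /rep; case: xgetP => [y _ //|/(_ x)]; case; split.
exists (rep @` lcosets H (H `&` N)); split.
- exact: finite_image.
- by move=> _ [_ [x Hx <-] <-]; case: (repP x Hx).
- move=> x Hx; exists (rep (lcoset (H `&` N) x)).
    by exists (lcoset (H `&` N) x) => //; exists x.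
  by have [_ /(lcoset_eq sHN)[]] := repP x Hx.
Qed.

End CentralSeries.

(** * The lower central series under epimorphisms *)

Section Epimorphism.
Variables (G Q : groupType) (f : UMagmaMorphism.type G Q).
Hypothesis f_surj : forall u, exists x, f x = u.

Lemma morph_lower_central n x : lower_central G n x -> lower_central Q n (f x).
Proof.
case: n => [//|n]; elim: n x => [//|n IH].
have sL := subgroup_lower_central Q n.+2.
suff: lower_central G n.+2 `<=` [set x | lower_central Q n.+2 (f x)].
  by move=> h x; apply: h.
apply: lower_centralS_sub.
  apply/subgroupP; split=> [|x y Lx Ly] /=.
    by rewrite gmulf1; apply: (subgroup1 sL).
  by rewrite gmulfF; apply: (subgroupF sL).
by move=> b x /IH Lb; rewrite /= gmulfR; apply: commg_lower_central.
Qed.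

(** Surjectivity supplies preimages of the second entries of the generating commutators. *)
Lemma morph_lower_central_surj n u :
  lower_central Q n u -> exists2 x, lower_central G n x & f x = u.
Proof.
case: n => [|n].
  by have [x <-] := f_surj u => _; exists x.
elim: n u => [|n IH]; first by move=> u _; have [x <-] := f_surj u; exists x.
have sL := subgroup_lower_central G n.+2.
suff: lower_central Q n.+2 `<=`
    [set u | exists2 x, lower_central G n.+2 x & f x = u].
  by move=> h u; apply: h.
apply: lower_centralS_sub.
  apply/subgroupP; split=> [|_ _ [x Lx <-] [y Ly <-]] /=.
    by exists 1; [apply: (subgroup1 sL)|rewrite gmulf1].
  by exists (x / y); [apply: (subgroupF sL)|rewrite gmulfF].
move=> _ y /IH[b Lb <-]; have [x <-] := f_surj y.
by exists [~ b, x]; [apply: commg_lower_central|rewrite gmulfR].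
Qed.

End Epimorphism.

(** * Words in a finite set, after Dietzmann *)

(** Pigeonhole: if w is longer than a sum of bounds m x over r, some x in r occurs in w more than m
    x times. *)
Lemma size_le_sum_count (T : eqType) (r w : seq T) : {subset w <= r} ->
  size w <= (\sum_(x <- r) count_mem x w)%N.
Proof.
elim: w => [//|y w IH] sub /=; rewrite big_split /= -addn1 addnC.
apply: leq_add; last by apply: IH => x xw; apply: sub; rewrite inE xw orbT.
rewrite -big_mkcond sum1_count /= -has_count.
by apply/hasP; exists y; [apply: sub; rewrite inE eqxx|rewrite /= eqxx].
Qed.

Section Words.
Variables (G : groupType) (X : set G).
Hypothesis XJ : forall x y, X x -> X y -> X (x ^ y).

Definition word (w : seq G) := forall x, x \in w -> X x.

Lemma word_cons x w : word (x :: w) <-> X x /\ word w.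
Proof.
split=> [h|[Xx Xw] y]; last by rewrite inE => /predU1P[->|/Xw].
by split=> [|y yw]; apply: h; rewrite inE ?eqxx // yw orbT.
Qed.

Lemma word_cat v w : word v -> word w -> word (v ++ w).
Proof. by move=> Xv Xw x; rewrite mem_cat => /orP[/Xv|/Xw]. Qed.

Lemma XJexp x y k : X x -> X y -> X (x ^ y ^+ k).
Proof.
move=> Xx Xy; elim: k => [|k IH]; first by rewrite conjg1.
by rewrite expgSr conjgM; apply: XJ.
Qed.

(** By y x^k = x^k y^(x^k), moving x to the left replaces the letters passed over by conjugates,
    still in X, and keeps the length. *)
Lemma word_collect x k w : X x -> word w -> k <= count_mem x w ->
  exists v, [/\ word v, size w = k + size v &
                \prod_(y <- w) y = x ^+ k * \prod_(y <- v) y].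
Proof.
move=> Xx; elim: w k => [|y w IH] [|k] /=.
- by move=> Xw _; exists [::]; rewrite mul1g.
- by [].
- by move=> Xw _; exists (y :: w); rewrite mul1g.
move=> /word_cons[Xy Xw]; have [->|neq] := eqVneq y x.
  rewrite /= add1n ltnS => /(IH _ Xw)[v [Xv sv pv]]; exists v; split=> //.
    by rewrite /= sv.
  by rewrite big_cons pv mulgA expgS.
rewrite /= add0n => /(IH _ Xw)[v [Xv sv pv]].
exists (y ^ x ^+ k.+1 :: v); split.
- by apply/word_cons; split=> //; apply: XJexp.
- by rewrite /= sv addnS.
- by rewrite !big_cons pv !mulgA mulgV mul1g.
Qed.

Hypothesis fX : finite_set X.

Lemma finite_bounded_words k :
  finite_set 
    [set g | exists w, [/\ word w, size w <= k & g = \prod_(y <- w) y]].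
Proof.
elim: k => [|k IH].
  apply: sub_finite_set (finite_set1 (1 : G)) => _ [[|y w] [_ //= _ ->]].
  by rewrite big_nil.
set P := [set g | _] in IH.
have fP : finite_set ([set 1] `|` [set x * y | x in X & y in P]).
  by rewrite finite_setU; split; [exact: finite_set1|exact: finite_image2].
apply: sub_finite_set fP => _ [[|y w] [Xw /= sw ->]].
  by left; rewrite big_nil.
right; rewrite big_cons; have /word_cons[Xy Xv] := Xw.
by exists y => //; exists (\prod_(z <- w) z) => //; exists w.
Qed.

(* A word containing x more than m times can be rearranged to start with
   x ^+ m.+1, and then shortened. *)
Lemma finite_words :
  (forall x, X x -> exists m w,
     [/\ word w, size w <= m & \prod_(y <- w) y = x ^+ m.+1]) ->
  finite_set [set g | exists2 w, word w & g = \prod_(y <- w) y].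
Proof.
move=> Xpow.
have /choice[m mP] : forall x, exists m, X x ->
    exists w, [/\ word w, size w <= m & \prod_(y <- w) y = x ^+ m.+1].
  move=> x; have [/Xpow[m mP]|nXx] := pselect (X x); first by exists m.
  by exists 0%N.
have /finite_seqP[r Xr] := fX.
pose B := (\sum_(x <- r) m x)%N.
have short w : word w -> B < size w ->
    exists v, [/\ word v, size v < size w &
                  \prod_(y <- v) y = \prod_(y <- w) y].
  move=> Xw Bw.
  have [x rx mx] : exists2 x, x \in r & m x < count_mem x w.
    apply: contrapT => nx; move: Bw; rewrite ltnNge => /negP; apply.
    have wr : {subset w <= r} by move=> y /Xw; rewrite Xr.
    apply: leq_trans (size_le_sum_count wr) _; rewrite big_seq [B]big_seq.
    apply: leq_sum => x rx; rewrite leqNgt; apply/negP => mx.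
    by apply: nx; exists x.
  have Xx : X x by rewrite Xr.
  have [v [Xv sv ->]] := word_collect Xx Xw mx.
  have [u [Xu su pu]] := mP x Xx.
  exists (u ++ v); split; first exact: word_cat.
    by rewrite sv size_cat addSn ltnS leq_add2r.
  by rewrite big_cat /= pu.
apply: sub_finite_set (finite_bounded_words B) => _ [w Xw ->].
have [k] := ubnP (size w); elim: k w Xw => // k IH w Xw; rewrite ltnS => wk.
have [wB|/(short w Xw)[v [Xv sv <-]]] := leqP (size w) B; first by exists w.
by apply: IH => //; apply: leq_trans sv wk.
Qed.

End Words.

(** * Finitely many central cosets covering gamma_(n+1) *)

Section CentralCover.
Variables (G : groupType) (n : nat) (S : set G).
Implicit Types (a b g u v w x y z : G).

Definition central z := forall g, z * g = g * z.

Hypothesis fS : finite_set S.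
Hypothesis SL : S `<=` lower_central G n.+1.
Hypothesis cS : forall x,
  lower_central G n.+1 x -> exists2 u, S u & central (u^-1 * x).

Lemma central_coverE x : lower_central G n.+1 x ->
  exists u z, [/\ S u, central z & x = u * z].
Proof. by move=> /cS[u Su cz]; exists u, (u^-1 * x); rewrite mulVKg. Qed.

Lemma conjg_central z : central z -> forall x, x ^ z = x.
Proof. by move=> cz x; rewrite conjgE -cz mulKg. Qed.

Lemma commgM_central a z g : central z -> [~ a * z, g] = [~ a, g].
Proof.
move=> cz; have -> : [~ a * z, g] = [~ a, g] ^ z * [~ z, g] by rewrite !gsimp.
have -> : [~ z, g] = 1 by rewrite commgEl conjgE cz mulKg mulVg.
by rewrite (conjg_central cz) mulg1.
Qed.

(** The indices i + 1 and j + 1 add up to s + 1 for s = n + 1. When i = 0, w lies in gamma_(n+1) and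
    conjugates as some u in S does. *)
Lemma finite_conj i j a : (i + j)%N = n -> lower_central G i.+1 a ->
  finite_set [set a ^ w | w in lower_central G j.+1].
Proof.
elim: i j a => [|i IH] j a ijn.
  move=> _; apply: sub_finite_set (finite_image (fun u => a ^ u) fS).
  move=> _ [w Lw <-].
  have /cS[u Su cz] : lower_central G n.+1 w by rewrite -ijn.
  exists u => //.
  by rewrite -[w](mulVKg u) conjgM (conjg_central cz).
(* Elements with finitely many conjugates under gamma_(j+1) form a subgroup, so a may be taken to be
   a commutator [b, x]. *)
move=> La; suff: lower_central G i.+2 `<=`
    [set a | finite_set [set a ^ w | w in lower_central G j.+1]].
  by move/(_ _ La).
apply: lower_centralS_sub => [|b x Lb] /=.
  apply/subgroupP; split=> [|y z fy fz] /=.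
    by apply: sub_finite_set (finite_set1 1) => _ [w _ <-]; rewrite /= conj1g.
  apply: sub_finite_set (finite_image2 (fun y z => y / z) fy fz) => _ [w Lw <-].
  exists (y ^ w); first by exists w.
  by exists (z ^ w); [exists w|rewrite conjMg conjVg].
(* These are the [b u, x v] with v in gamma_(j+2). Since u is in gamma_(n+1), (b u)^x is in
   gamma_(i+1), and the hypothesis at j + 1 gives finiteness. *)
pose F u := [set (b * u)^-1 * c | c in
               [set ((b * u) ^ x) ^ v | v in lower_central G j.+2]].
have fF : finite_set (\bigcup_(u in S) F u).
  apply: bigcup_finite => // u Su; apply: finite_image; apply: IH.
    by rewrite addnS.
  have [sL nL] := normal_lower_central G i.+1.
  apply: nL; apply: (subgroupM sL) => //; apply: lower_central_sub (SL Su).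
  by rewrite ltnS -ijn addSn (leq_trans (leq_addr j i)).
apply: sub_finite_set fF => _ [w Lw <-].
have : lower_central G n.+1 [~ b, w].
  by rewrite -ijn addSn; apply: commg_lower_central2.
move=> /central_coverE[u [z [Su cz ez]]]; exists u => //.
exists (((b * u) ^ x) ^ [~ x, w]).
  exists [~ x, w] => //; rewrite -invgR.
  apply: (subgroupV (subgroup_lower_central _ _)).
  exact: commg_lower_central.
rewrite conjRg -conjgM [x * _]mulVKg.
have -> : b ^ w = b * u * z by rewrite -mulgA -ez mulVKg.
by rewrite commgM_central.
Qed.

Definition section_commutators : set G :=
  [set [~ a, g] | a in lower_central G n.+1 & g in [set: G]].

Local Notation X := section_commutators.

(** For central z, [u z, g] = u^-1 u^g; as gamma_1 is G, [finite_conj] with i = n and j = 0 leaves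
    finitely many u^g. *)
Lemma finite_section_commutators : finite_set X.
Proof.
pose F u := [set u^-1 * c | c in [set u ^ g | g in lower_central G 1]].
have fF : finite_set (\bigcup_(u in S) F u).
  apply: bigcup_finite => // u /SL Lu; apply: finite_image.
  by apply: finite_conj Lu; rewrite addn0.
apply: sub_finite_set fF => _ [a /central_coverE[u [z [Su cz ->]]] [g _ <-]].
by exists u => //; exists (u ^ g); [exists g|rewrite commgM_central].
Qed.

(** Taking one more power of x than [r] has entries, some x^i and x^j with i < j share a
    representative u. Then u^-1 x^i and u^-1 x^j are central, hence so is x^(j-i). *)
Lemma power_central x : lower_central G n.+1 x -> exists m, central (x ^+ m.+1).
Proof.
move=> Lx; have sL := subgroup_lower_central G n.+1.
have LxX i : lower_central G n.+1 (x ^+ i).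
  elim: i => [|i IH]; first exact: (subgroup1 sL).
  by rewrite expgS; apply: (subgroupM sL).
have /choice[u uP] : forall i, exists u, S u /\ central (u^-1 * x ^+ i).
  by move=> i; have [u] := cS (LxX i); exists u.
have /finite_seqP[r Sr] := fS.
pose us := [seq u i | i <- iota 0 (size r).+1].
have Nus : ~~ uniq us.
  apply/negP => /uniq_leq_size le.
  have /le : {subset us <= r}.
    by move=> _ /mapP[i _ ->]; have [] := uP i; rewrite Sr.
  by rewrite size_map size_iota ltnn.
have [i [j [ij]]] := uniqPn 1 Nus.
rewrite size_map size_iota => jr; have ir := ltn_trans ij jr.
rewrite !(nth_map 0%N) ?size_iota // !nth_iota // !add0n => uij.
exists (j - i).-1; rewrite prednK ?subn_gt0 // => g.
have [_] := uP j; rewrite -uij.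
rewrite -[in x ^+ j](subnKC (ltnW ij)) expgnDr mulgA.
have [_] := uP i; set p := _ * _; set q := x ^+ (j - i) => cp cpq.
by apply: (@mulgI _ p); rewrite mulgA cpq mulgA -cp -mulgA.
Qed.

(** X generates gamma_(n+2) and is closed under inversion, so every element of gamma_(n+2) is a word
    in X and [finite_words] applies. *)
Lemma finite_lower_centralS : finite_set (lower_central G n.+2).
Proof.
have [sL nL] := normal_lower_central G n.+1.
have XJ x y : X x -> X y -> X (x ^ y).
  case=> a La [g _ <-] _; exists (a ^ y); first exact: nL.
  by exists (g ^ y); rewrite ?conjRg.
have XV x : X x -> X x^-1.
  (* [a, g]^-1 = [a^g, g^-1]. *)
  case=> a La [g _ <-]; exists (a ^ g); first exact: nL.
  by exists g^-1 => //; rewrite !gsimp.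
have Xpow x : X x -> exists m (w : seq G),
    [/\ word X w, size w <= m & \prod_(y <- w) y = x ^+ m.+1].
  move=> Xx; have [a La [g _ xE]] := Xx.
  have [|m cm] := @power_central x.
    rewrite -xE commgEl; apply: (subgroupM sL); last exact: nL.
    exact: (subgroupV sL).
  have Xa : X (x ^ a).
    by exists a => //; exists (g ^ a); rewrite // -xE conjRg !gsimp.
  (* x ^+ m.+2 = a^-1 * x ^+ m.+1 * a ^ g = (x ^ a) ^+ m * [~ a ^+ 2, g] *)
  exists m.+1, (nseq m (x ^ a) ++ [:: [~ a ^+ 2, g]]); split.
  - apply: word_cat => y; first by move=> /nseqP[->].
    rewrite inE => /eqP->.
    by exists (a ^+ 2) => //; [apply: (subgroupM sL)|exists g].
  - by rewrite size_cat size_nseq addn1.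
  - rewrite big_cat big_seq1 big_nseq /= iter_mulg_1 -conjXg expgSr.
    have -> : [~ a ^+ 2, g] = a^-1 * x * a ^ g.
      by rewrite -xE expg2 !gsimp.
    have -> : x ^+ m ^ a * (a^-1 * x * a ^ g) = a^-1 * (x ^+ m.+1 * a ^ g).
      by rewrite expgSr !gsimp.
    by rewrite [_ * a ^ g]cm mulgA -commgEl xE -expgS.
apply: sub_finite_set (finite_words XJ finite_section_commutators Xpow).
apply: generated_sub => [|x Xx]; last first.
  exists [:: x]; last by rewrite big_seq1.
  by move=> y; rewrite inE => /eqP->.
apply/subgroupP; split; first by exists [::]; rewrite ?big_nil.
move=> _ _ [v Xv ->] [w Xw ->].
exists (v ++ rev [seq y^-1 | y <- w]); last first.
  rewrite big_cat /=; congr (_ * _).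
  elim: (w) => [|y s IH]; first by rewrite !big_nil invg1.
  by rewrite big_cons invgM /= rev_cons -cats1 big_cat big_seq1 IH.
apply: word_cat => // y; rewrite mem_rev => /mapP[z zw ->].
by apply: XV; apply: Xw.
Qed.

End CentralCover.

(** * The induction step through a quotient, and the theorem *)

(** Z_(k+1)(G) maps into the center of Q = G / Z_k(G), so the images of the representatives cover
    gamma_(n+1)(Q) modulo the center. Then gamma_(n+2)(Q) is finite, and one preimage in
    gamma_(n+2)(G) of each element gives the new representatives. *)
Lemma finite_index_step (G : groupType) n k :
  finite_index (lower_central G n.+1)
    (lower_central G n.+1 `&` upper_central G k.+1) ->
  finite_index (lower_central G n.+2)
    (lower_central G n.+2 `&` upper_central G k).
Proof.
have sL m := subgroup_lower_central G m.
have nZ m := normal_upper_central G m; have sZ m := normal_subgroup (nZ m).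
move=> /(finite_indexP (sL _) (sZ _))[S [fS SL cS]].
pose p : UMagmaMorphism.type G (quotient (nZ k)) := proj (nZ k).
have p_surj u : exists x, p x = u by exists (repr u); apply: proj_repr.
have pL m x : lower_central G m x -> lower_central _ m (p x).
  exact: morph_lower_central.
have fL : finite_set (lower_central (quotient (nZ k)) n.+2).
  apply: (finite_lower_centralS (finite_image p fS)).
    by move=> _ [u Su <-]; apply/pL/SL.
  move=> _ /(morph_lower_central_surj p_surj)[x Lx <-].
  have [u Su /upper_centralSP Zux] := cS x Lx.
  exists (p u); first by exists u.
  rewrite -gmulfV -gmulfM => v; have [g <-] := p_surj v.
  rewrite -!gmulfM; apply/esym/projP.
  by have := Zux g; rewrite !gsimp.
apply/(finite_indexP (sL _) (sZ _)).
pose r u := xget 1 [set x | lower_central G n.+2 x /\ p x = u].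
have rP u : lower_central _ n.+2 u -> lower_central G n.+2 (r u) /\ p (r u) = u.
  move=> /(morph_lower_central_surj p_surj)[x Lx px].
  by rewrite /r; case: xgetP => [y _ //|/(_ x)]; case; split.
exists (r @` lower_central _ n.+2); split; first exact: finite_image.
  by move=> _ [u /rP[Lr _] <-].
move=> x /pL Lpx; exists (r (p x)); first by exists (p x).
by apply/(projP (nZ k)); case: (rP _ Lpx).
Qed.

Theorem theoremB (G : groupType) (s t : nat) (hs : 1 <= s)
    (hfin : finite_index (lower_central G s)
              (lower_central G s `&` upper_central G t)) :
  (forall j : nat, 0 <= j <= t ->
     finite_index (lower_central G (s + j))
       (lower_central G (s + j) `&` upper_central G (t - j))) /\
  finite_set (lower_central G (s + t)).
Proof.
have fin j : 0 <= j <= t -> finite_index (lower_central G (s + j))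
    (lower_central G (s + j) `&` upper_central G (t - j)).
  case: s hs hfin => // n _ h0; elim: j => [|j IH] /= jt.
    by rewrite addn0 subn0.
  (* As j < t, the successor of t - (j + 1) is t - j despite truncated subtraction. *)
  rewrite addnS; apply: finite_index_step; rewrite -subSn // subSS.
  exact: IH (ltnW jt).
split=> //; have := fin t; rewrite leqnn subnn => /(_ isT).
have sZ := normal_subgroup (normal_upper_central G 0).
(* Z_0(G) is trivial, so each element equals its representative and S contains gamma_(s+t)(G). *)
move=> /(finite_indexP (subgroup_lower_central _ _) sZ)[S [fS _ cS]].
apply: sub_finite_set fS => x /cS[u Su /= ux1].
by rewrite -[x](mulVKg u) ux1 mulg1.
Qed.
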